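(* Let $D\subset\mathbb{R}^2$ be a compact convex domain, let $\delta>0$, and let $f:\mathbb{R}^2\to\mathbb{R}$ be a continuous map satisfying one of the following conditions: (i) $f(x)\geq 0$ for all $x\in\mathbb{R}^2\setminus D$, and $f(x)\leq 0$ whenever $\operatorname{dist}(x,\partial D)\leq\delta$; (ii) $f(x)\leq 0$ for all $x\in\mathbb{R}^2\setminus D$, and $f(x)\geq 0$ whenever $\operatorname{dist}(x,\partial D)\leq\delta$. Then, for every $a$ with $0<a<\frac{\sqrt2}{2}\delta$, there exist a point $p\in D$ and a square in $\mathbb{R}^2$ centered at $p$, with side length $a$, such that $f$ takes the same value at the four vertices of the square.
   Context: A compact convex domain in $\mathbb{R}^2$ means a compact convex set with nonempty interior. $\operatorname{dist}(x,\partial D)$ is the Euclidean distance from $x\in\mathbb{R}^2$ (inside or outside $D$) to the boundary $\partial D$. Squares may be arbitrarily rotated (sides need not be parallel to the axes). *)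

(* Defs.v *)
From mathcomp Require Import all_boot all_order all_algebra.
From mathcomp Require Import all_classical all_reals all_analysis.

Set Implicit Arguments.
Unset Strict Implicit.
Unset Printing Implicit Defensive.

Import Order.TTheory GRing.Theory Num.Theory.
Import numFieldNormedType.Exports.

Local Open Scope classical_set_scope.
Local Open Scope ring_scope.

(* The plane is R * R. Its library norm is the sup norm: it induces the usual
   topology, but Euclidean lengths have to be defined separately. *)

Definition dotp (R : realType) (u v : R * R) : R := u.1 * v.1 + u.2 * v.2.

Definition edist2 (R : realType) (x y : R * R) : R :=
  Num.sqrt (dotp (x - y) (x - y)).

Definition dist_to (R : realType) (x : R * R) (A : set (R * R)) : R :=
  inf [set edist2 x y | y in A].

Definition boundary (T : topologicalType) (A : set T) : set T :=
  closure A `\` A°.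

Definition compact_convex_domain (R : realType) (D : set (R * R)) : Prop :=
  [/\ compact D, convex_set D & D° !=set0].

(* v1, v2, v3, v4 are the vertices, in cyclic order, of a square with center p
   and side length a: both diagonals have midpoint p (a parallelogram), two
   adjacent sides have length a, and these sides are orthogonal. *)
Definition is_square (R : realType) (p : R * R) (a : R)
    (v1 v2 v3 v4 : R * R) : Prop :=
  [/\ 2^-1 *: (v1 + v3) = p, 2^-1 *: (v2 + v4) = p,
      edist2 v1 v2 = a, edist2 v2 v3 = a & dotp (v2 - v1) (v3 - v2) = 0].

(* Main.v *)
Require Import Defs.
From mathcomp Require Import all_boot all_order all_algebra.
From mathcomp Require Import all_classical all_reals all_analysis.
From mathcomp Require Import zify ring lra.

(** The squares with a fixed half diagonal r are given by a center p and a unit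
    vector e, with vertices p + r e, p + r e', p - r e, p - r e', where e' is e
    turned by a right angle. Two continuous quantities measure how far f is from
    being constant on the vertices:
    - the vector w = (f(p + r e) - f(p - r e)) e + (f(p + r e') - f(p - r e')) e',
      a discrete gradient, which does not change when e is replaced by e';
    - the number g = (f(p + r e) + f(p - r e)) - (f(p + r e') + f(p - r e')),
      which changes sign when e is replaced by e'.
    The four values agree exactly when w = 0 and g = 0, so a common zero of w
    and g with p in D is needed, e running over a quarter of the circle.

    The hypotheses on f enter through one inequality
    ([skew_dotp_normal_ge0]): if n is an outer normal of D at a boundary point
    q, then n.w >= 0. Indeed, of two opposite vertices around q, the one on the
    side of n lies outside D and close to the boundary, so f vanishes there,
    whereas f <= 0 at the opposite one. Let pr be the nearest-point projection
    on D. Then p - pr(p) is an outer normal at pr(p), hence the extension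
    W(p) = w(pr(p)) + p - pr(p) of w to the plane has no zero off D. Since D is
    compact, W(p) - p is bounded, and W points outwards on the faces of any
    large enough square box.

    What remains is purely topological ([antiperiodic_common_zero]). For fixed
    e, the map W has degree 1 on the box. If W and g had no common zero, the
    zeros of W where g > 0 and those where g < 0 would never meet as e varies
    over the quarter turn, so the degree carried by the zeros with g > 0 would
    be constant. But at the end of the quarter turn W is the same map as at the
    start and g has the opposite sign, so the two kinds of zeros would carry the
    same degree, and the total degree would be even. Only parities matter, so
    the degree is replaced by a count on a fine grid
    ([mixed_cube_exists]): the zeros of W are detected by the number modulo 2
    of edges, around each small square, that cross the upper half of the second
    axis. The second alternative of the theorem is the first one for - f. *)

Set Implicit Arguments.
Unset Strict Implicit.
Unset Printing Implicit Defensive.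

Import Order.TTheory GRing.Theory Num.Theory.
Import numFieldNormedType.Exports.

Local Open Scope classical_set_scope.
Local Open Scope ring_scope.

(** * A parity argument on a cubical grid *)

Lemma telescope_addb (F : nat -> bool) n :
  \big[addb/false]_(i < n) (F i (+) F i.+1) = F 0%N (+) F n.
Proof.
elim: n => [|n IHn]; first by rewrite big_ord0 addbb.
by rewrite big_ord_recr IHn /=; case: (F 0%N); case: (F n); case: (F n.+1).
Qed.

(** Every inner edge of the grid bounds two unit squares and cancels modulo 2. *)
Lemma stokes_grid (A B : nat -> nat -> bool) n :
  \big[addb/false]_(i < n) \big[addb/false]_(j < n)
     ((A i j (+) A i j.+1) (+) (B i j (+) B i.+1 j)) =
  \big[addb/false]_(i < n) (A i 0%N (+) A i n) (+)
  \big[addb/false]_(j < n) (B 0%N j (+) B n j).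
Proof.
under eq_bigr do rewrite big_split.
rewrite big_split /=; congr addb.
  by apply: eq_bigr => i _; rewrite telescope_addb.
rewrite exchange_big /=.
by apply: eq_bigr => j _; rewrite (telescope_addb (B^~ j)).
Qed.

(** A pair of booleans records the signs of the two coordinates of a planar
    vector; an edge is counted when it crosses the half-line where the first
    coordinate vanishes and the second one is positive. *)
Definition crossing (p q : bool * bool) := [&& p.2, q.2 & p.1 (+) q.1].

(** Modulo 2, the winding number around the origin of the closed polygon
    p, q, r, s. *)
Definition winding (p q r s : bool * bool) :=
  (crossing p q (+) crossing s r) (+) (crossing p s (+) crossing q r).

Lemma winding_same1 b p2 q2 r2 s2 :
  winding (b, p2) (b, q2) (b, r2) (b, s2) = false.
Proof. by move: b p2 q2 r2 s2; do 5!case. Qed.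

Lemma winding_same2 b p1 q1 r1 s1 :
  winding (p1, b) (q1, b) (r1, b) (s1, b) = false.
Proof. by move: b p1 q1 r1 s1; do 5!case. Qed.

(** A polygon that stays in a half-plane bounded by a coordinate axis does not
    wind around the origin. *)
Lemma winding_mixed p q r s (b : bool) : winding p q r s ->
  b \in [:: p.1; q.1; r.1; s.1] /\ b \in [:: p.2; q.2; r.2; s.2].
Proof.
by move: p q r s b => [p1 p2] [q1 q2] [r1 r2] [s1 s2] b;
  move: b p1 p2 q1 q2 r1 r2 s1 s2; do 9!case.
Qed.

(** The boundary of a cube is a closed surface: each of its edges lies on two
    faces. The top and the bottom face therefore balance the four lateral ones. *)
Lemma winding_cube p q r s p' q' r' s' :
  winding p q r s (+) winding p' q' r' s' =
  (winding p q q' p' (+) winding s r r' s') (+)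
  (winding p s s' p' (+) winding q r r' q').
Proof.
rewrite /winding.
move: (crossing p q) (crossing s r) (crossing p s) (crossing q r).
move: (crossing p' q') (crossing s' r') (crossing p' s') (crossing q' r').
move: (crossing p p') (crossing q q') (crossing r r') (crossing s s').
by do 12!case.
Qed.

Definition corners (x : nat -> nat -> nat -> bool) i j k :=
  [:: x i j k; x i.+1 j k; x i j.+1 k; x i.+1 j.+1 k;
      x i j k.+1; x i.+1 j k.+1; x i j.+1 k.+1; x i.+1 j.+1 k.+1].

Definition mixed x i j k :=
  (true \in corners x i j k) && (false \in corners x i j k).

Lemma mixedP x i j k (b : bool) : mixed x i j k ->
  exists i' j' k' : nat,
    [/\ (i <= i' <= i.+1)%N, (j <= j' <= j.+1)%N, (k <= k' <= k.+1)%N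
      & x i' j' k' = b].
Proof.
case/andP=> ht hf; have : b \in corners x i j k by case: b.
rewrite !inE => /or4P[/eqP->|/eqP->|/eqP->|/orP[/eqP->|/or4P[]/eqP->]];
  [exists i, j, k | exists i.+1, j, k | exists i, j.+1, k | exists i.+1, j.+1, k
  |exists i, j, k.+1 | exists i.+1, j, k.+1 | exists i, j.+1, k.+1
  |exists i.+1, j.+1, k.+1]; by rewrite !leqnn !leqnSn.
Qed.

Lemma unmixed_eq x i j k b c : ~~ mixed x i j k ->
  b \in corners x i j k -> c \in corners x i j k -> b = c.
Proof. by rewrite /mixed; case: b; case: c => // + h h'; rewrite h h'. Qed.

Lemma mixed_face (x y : nat -> nat -> nat -> bool) i j k p q r s :
  {subset [:: p.1; q.1; r.1; s.1] <= corners x i j k} ->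
  {subset [:: p.2; q.2; r.2; s.2] <= corners y i j k} ->
  winding p q r s -> mixed x i j k && mixed y i j k.
Proof.
move=> sx sy w; have [t1 t2] := winding_mixed true w.
have [f1 f2] := winding_mixed false w.
by rewrite /mixed !sx ?sy.
Qed.

(** The total winding is that of the contour of the grid, where only the side
    with positive second coordinate contributes; along it the first coordinate
    changes sign, an odd number of times. *)
Lemma sum_winding (v : nat -> nat -> bool * bool) n :
  (forall j, (v 0%N j).1 = false) -> (forall j, (v n j).1 = true) ->
  (forall i, (v i 0%N).2 = false) -> (forall i, (v i n).2 = true) ->
  \big[addb/false]_(i < n) \big[addb/false]_(j < n)
    winding (v i j) (v i.+1 j) (v i.+1 j.+1) (v i j.+1).
Proof.
move=> x0 xn y0 yn.
rewrite (stokes_grid (fun i j => crossing (v i j) (v i.+1 j))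
                     (fun i j => crossing (v i j) (v i j.+1))).
rewrite [X in _ (+) X]big1 => [|j _]; last first.
  by rewrite /crossing !x0 !xn /= !andbF.
rewrite addbF.
under eq_bigr => i _ do rewrite /crossing !y0 !yn /=.
by rewrite (telescope_addb (fun i => (v i n).1)) x0 xn.
Qed.

(** Otherwise [s] would be constant on each cube one of whose faces has a
    nonzero winding. Then A(k), the winding of the layer k summed over the
    squares with [s] true, would not depend on [k], because the lateral faces
    cancel or lie on the sides of the grid. But the layers [0] and [n] carry the
    same squares with opposite values of [s], so A(0) + A(n) is the full winding
    of a layer, which is odd. *)
Lemma mixed_cube_exists (x y s : nat -> nat -> nat -> bool) n :
  (forall j k, x 0%N j k = false) -> (forall j k, x n j k = true) ->
  (forall i k, y i 0%N k = false) -> (forall i k, y i n k = true) ->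
  (forall i j, x i j n = x i j 0%N) -> (forall i j, y i j n = y i j 0%N) ->
  (forall i j, s i j n = ~~ s i j 0%N) ->
  exists i j k, [/\ mixed x i j k, mixed y i j k & mixed s i j k].
Proof.
move=> x0 xn y0 yn xper yper sper; apply: contrapT => noM.
have sE i j k b c : mixed x i j k && mixed y i j k ->
    b \in corners s i j k -> c \in corners s i j k -> b = c.
  move=> /andP[hx hy]; apply: unmixed_eq.
  by apply/negP => hs; apply: noM; exists i, j, k.
pose v i j k := (x i j k, y i j k).
pose Q i j k := winding (v i j k) (v i.+1 j k) (v i.+1 j.+1 k) (v i j.+1 k).
pose A k := \big[addb/false]_(i < n) \big[addb/false]_(j < n) (s i j k && Q i j k).
have sub4 (t : nat -> nat -> nat -> bool) i j k a b c d :
   all (mem (corners t i j k)) [:: a; b; c; d] ->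
   {subset [:: a; b; c; d] <= corners t i j k} by move/allP.
have AS k : A k = A k.+1.
  suff: A k (+) A k.+1 = false by case: (A k); case: (A k.+1).
  rewrite -big_split /=.
  (* Over the layer k, these are the two families of vertical faces. *)
  pose F1 i j := winding (v i j k) (v i.+1 j k) (v i.+1 j k.+1) (v i j k.+1).
  pose F2 i j := winding (v i j k) (v i j.+1 k) (v i j.+1 k.+1) (v i j k.+1).
  rewrite (_ : \big[_/_]_(i < n) _ = \big[addb/false]_(i < n) \big[addb/false]_(j < n)
     (((s i j k && F1 i j) (+) (s i j.+1 k && F1 i j.+1)) (+)
      ((s i j k && F2 i j) (+) (s i.+1 j k && F2 i.+1 j)))).
    rewrite (stokes_grid (fun i j => s i j k && F1 i j)
                         (fun i j => s i j k && F2 i j)).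
    rewrite !big1 // => i _.
      by rewrite /F2 /v !x0 !xn !winding_same1 !andbF.
    by rewrite /F1 /v !y0 !yn !winding_same2 !andbF.
  apply: eq_bigr => i _; rewrite -big_split; apply: eq_bigr => j _ /=.
  (* A face with nonzero winding makes its cube mixed for x and y, so s takes the
     same value at any two corners of that cube. *)
  have moveS b c p q r t : (winding p q r t ->
       [/\ {subset [:: p.1; q.1; r.1; t.1] <= corners x i j k},
           {subset [:: p.2; q.2; r.2; t.2] <= corners y i j k},
           b \in corners s i j k & c \in corners s i j k]) ->
      b && winding p q r t = c && winding p q r t.
    move=> face; case w: (winding p q r t); last by rewrite !andbF.
    have [sx sy hb hc] := face w.
    by rewrite (sE _ _ _ _ _ (mixed_face sx sy w) hb hc).
  rewrite -(moveS (s i j k) (s i j k.+1)); last first.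
    by move=> _; split; [apply: sub4 | apply: sub4 | |]; rewrite /= !inE !eqxx ?orbT.
  rewrite -(moveS (s i j k) (s i j.+1 k)); last first.
    by move=> _; split; [apply: sub4 | apply: sub4 | |]; rewrite /= !inE !eqxx ?orbT.
  rewrite -(moveS (s i j k) (s i.+1 j k)); last first.
    by move=> _; split; [apply: sub4 | apply: sub4 | |]; rewrite /= !inE !eqxx ?orbT.
  by case: (s i j k) => //=; exact: winding_cube.
have A0 k : A k = A 0%N by elim: k => // k IH; rewrite -AS.
have : A 0%N (+) A n = true.
  have <- := @sum_winding (fun i j => v i j 0%N) n (fun j => x0 j _)
    (fun j => xn j _) (fun i => y0 i _) (fun i => yn i _).
  rewrite -big_split.
  apply: eq_bigr => i _; rewrite -big_split; apply: eq_bigr => j _ /=.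
  rewrite sper /Q /v !xper !yper.
  by case: (s i j 0%N) => //=; rewrite addbF.
by rewrite A0 addbb.
Qed.

(** * Common zeros of a periodic pair and an antiperiodic function *)

Definition sign_change (R : realType) (T : pseudoMetricType R) (F : T -> R)
    (e : R) (z : T) :=
  (exists2 z', ball z e z' & F z' <= 0) /\ (exists2 z', ball z e z' & 0 <= F z').

(** The local half of the compactness argument: stated for all points near [z]
    and all small radii, so that finitely many such neighbourhoods can be merged
    into a common radius. *)
Lemma near_no_sign_change (R : realType) (T : pseudoMetricType R) (F : T -> R) (z : T) :
  {for z, continuous F} -> F z <> 0 ->
  \forall z' \near z & e \near (0 : R)^'+, ~ sign_change F e z'.
Proof.
move=> cF Fz0.
have [d d0 dP] : exists2 d : R, 0 < d &
    forall z', ball z d z' -> 0 < F z * F z'.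
  have /cvgrPdist_lt/(_ `|F z|) := cF.
  rewrite normr_gt0 => /(_ (introN eqP Fz0))/nbhs_ballP[d /= d0 dP].
  exists d => // z' /dP /=; rewrite ltr_norml.
  by have [?|?|/Fz0] := ltgtP (F z) 0 => //;
    [rewrite ltr0_norm//|rewrite gtr0_norm//] => ?; nra.
exists (ball z (d / 2), [set e | e < d / 2]).
  split; first by apply: nbhsx_ballx; lra.
  by apply: nbhs_right_lt; lra.
move=> [z' e] /= [zz' ed] [[z1 b1 h1] [z2 b2 h2]].
have near z0 : ball z' e z0 -> 0 < F z * F z0.
  move=> b; apply: dP; rewrite -(subrK (d / 2) d).
  have -> : d - d / 2 = d / 2 by lra.
  by apply: ball_triangle zz' _; apply: le_ball b; exact: ltW.
by have := near _ b1; have := near _ b2; nra.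
Qed.

(** If there were no common zero, compactness would give a radius [e] such that
    on no ball of radius [e] centered in the unit cube the three functions all
    change sign; a grid of mesh less than [e] contains a cell where they all do. *)
Lemma antiperiodic_common_zero (R : realType) (X Y G : R * R * R -> R) :
  continuous X -> continuous Y -> continuous G ->
  let I : set R := `[0, 1]%classic in
  (forall v t, I v -> I t -> X (0, v, t) < 0 /\ 0 < X (1, v, t)) ->
  (forall u t, I u -> I t -> Y (u, 0, t) < 0 /\ 0 < Y (u, 1, t)) ->
  (forall u v, I u -> I v ->
    [/\ X (u, v, 1) = X (u, v, 0), Y (u, v, 1) = Y (u, v, 0)
      & G (u, v, 1) = - G (u, v, 0)]) ->
  exists z, [/\ X z = 0, Y z = 0 & G z = 0].
Proof.
move=> cX cY cG I hX hY hP; apply: contrapT => noz.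
have cK : compact (I `*` I `*` I).
  by do 2 (apply: compact_setX; last exact: segment_compact); exact: segment_compact.
have : \forall e \near (0 : R)^'+, (I `*` I `*` I) `<=`
    [set z | ~ [/\ sign_change X e z, sign_change Y e z & sign_change G e z]].
  move/compact_near_coveringP : cK; apply => z Kz.
  have [Xz|/eqP Xz] := eqVneq (X z) 0; last first.
    have := near_no_sign_change (cX z) Xz.
    by apply: filterS => -[z' e] /= h [].
  have [Yz|/eqP Yz] := eqVneq (Y z) 0; last first.
    have := near_no_sign_change (cY z) Yz.
    by apply: filterS => -[z' e] /= h [].
  have Gz : G z <> 0 by move=> Gz; apply: noz; exists z.
  have := near_no_sign_change (cG z) Gz.
  by apply: filterS => -[z' e] /= h [].
move=> nearE; near ((0 : R)^'+) => e.
have ev : (I `*` I `*` I) `<=`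
    [set z | ~ [/\ sign_change X e z, sign_change Y e z & sign_change G e z]].
  near: e; exact: nearE.
have e0 : 0 < e by near: e; exact: nbhs_right_gt.
have [n ne] : exists n, n.+1%:R^-1 < e.
  exists (Num.truncn e^-1).
  by rewrite invf_plt ?posrE// truncnS_gt.
(* The minimum makes h total on nat with value 1 beyond the grid, as the
   combinatorial lemma has no bounds on the indices. *)
pose h i : R := (minn i n.+1)%:R / n.+1%:R.
have h0 : h 0%N = 0 by rewrite /h min0n mul0r.
have h1 : h n.+1 = 1 by rewrite /h minnn divff// pnatr_eq0.
have hI i : I (h i).
  rewrite /I /= in_itv /= /h divr_ge0//= ler_pdivrMr ?ltr0n// mul1r ler_nat.
  exact: geq_minr.
have hS i i' : (i <= i' <= i.+1)%N -> ball (h i) e (h i').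
  move=> ii; rewrite /ball /= /h -mulrBl normrM.
  rewrite (ger0_norm (_ : 0 <= n.+1%:R^-1)) ?invr_ge0//.
  apply: le_lt_trans ne; rewrite ler_piMl ?invr_ge0//.
  have : (minn i n.+1 <= minn i' n.+1 <= (minn i n.+1).+1)%N by lia.
  rewrite -!(ler_nat R) -natr1 ler_norml => ?; lra.
pose pt i j k := (h i, h j, h k).
pose x i j k := 0 < X (pt i j k).
pose y i j k := 0 < Y (pt i j k).
(* G may vanish at a node: counting 0 as negative below the top layer and as
   positive on it keeps the top signs opposite to the bottom ones. *)
pose s i j k := if (k < n.+1)%N then 0 < G (pt i j k) else 0 <= G (pt i j k).
have [|||||||i [j [k [mx my ms]]]] := @mixed_cube_exists x y s n.+1.
- by move=> j k; apply/negbTE; rewrite -leNgt ltW// /pt h0; case: (hX _ _ (hI j) (hI k)).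
- by move=> j k; rewrite /x /pt h1; case: (hX _ _ (hI j) (hI k)).
- by move=> j k; apply/negbTE; rewrite -leNgt ltW// /pt h0; case: (hY _ _ (hI j) (hI k)).
- by move=> j k; rewrite /y /pt h1; case: (hY _ _ (hI j) (hI k)).
- by move=> i j; rewrite /x /pt h0 h1; case: (hP _ _ (hI i) (hI j)) => ->.
- by move=> i j; rewrite /y /pt h0 h1; case: (hP _ _ (hI i) (hI j)) => _ ->.
- move=> i j; rewrite /s /= ltnn /pt h0 h1.
  by case: (hP _ _ (hI i) (hI j)) => _ _ ->; rewrite oppr_ge0 leNgt.
have nearpt i' j' k' : (i <= i' <= i.+1)%N -> (j <= j' <= j.+1)%N ->
    (k <= k' <= k.+1)%N -> ball (pt i j k) e (pt i' j' k').
  by move=> *; split; [split|]; exact: hS.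
have sc (b : nat -> nat -> nat -> bool) F :
    (forall i j k, b i j k -> 0 <= F (pt i j k)) ->
    (forall i j k, b i j k = false -> F (pt i j k) <= 0) ->
    mixed b i j k -> sign_change F e (pt i j k).
  move=> bt bf mb; split.
    have [i' [j' [k' [hi hj hk /bf]]]] := mixedP false mb.
    by exists (pt i' j' k') => //; exact: nearpt.
  have [i' [j' [k' [hi hj hk /bt]]]] := mixedP true mb.
  by exists (pt i' j' k') => //; exact: nearpt.
apply: (ev (pt i j k)); first by do !split; exact: hI.
split.
- by apply: sc mx => ? ? ?; [exact: ltW | move/negbT; rewrite -leNgt].
- by apply: sc my => ? ? ?; [exact: ltW | move/negbT; rewrite -leNgt].
- apply: sc ms => i' j' k'; rewrite /s; case: ifP => // _.
  + exact: ltW.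
  + by move/negbT; rewrite -leNgt.
  + by move/negbT; rewrite -ltNge => /ltW.
Unshelve. all: by end_near. Qed.

(** * Normal vectors of a convex set and projection on it *)

Definition normal_at (R : realType) (D : set (R * R)) (q n : R * R) :=
  D q /\ forall y, D y -> dotp n (y - q) <= 0.

Lemma dotp_ge0 (R : realType) (u : R * R) : 0 <= dotp u u.
Proof. by rewrite addr_ge0// -expr2 sqr_ge0. Qed.

Lemma dotp_eq0 (R : realType) (u : R * R) : dotp u u <= 0 -> u = 0.
Proof.
case: u => a b; rewrite /dotp /= => h.
have -> : a = 0 by nra.
by have -> : b = 0 by nra.
Qed.

Lemma convex_segment (R : realType) (D : set (R * R)) (x y : R * R) (l : R) :
  convex_set D -> D x -> D y -> 0 <= l <= 1 -> D (x + l *: (y - x)).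
Proof.
move=> cD Dx Dy /andP[l0 l1].
have := cD y x (Itv01 l0 l1).
rewrite !inE => /(_ Dy Dx) => h.
have -> // : x + l *: (y - x) = l *: y + (1 - l) *: x.
by rewrite scalerBr scalerBl scale1r addrCA addrA.
Qed.

Lemma continuous_app (S T U : topologicalType) (h : T -> U) (F : S -> T) :
  continuous h -> continuous F -> continuous (fun x => h (F x)).
Proof. by move=> ch cF x; apply: continuous_comp; [exact: cF | exact: ch]. Qed.

Lemma continuous_pair (S T U : topologicalType) (F : S -> T) (G : S -> U) :
  continuous F -> continuous G -> continuous (fun x => (F x, G x)).
Proof. by move=> cF cG x; apply: cvg_pair; [exact: cF | exact: cG]. Qed.

Lemma continuous_fst (T U : topologicalType) : continuous (@fst T U).
Proof. by move=> x; exact: cvg_fst. Qed.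

Lemma continuous_snd (T U : topologicalType) : continuous (@snd T U).
Proof. by move=> x; exact: cvg_snd. Qed.

Lemma continuous_add (R : realType) (V : normedModType R) (T : topologicalType)
  (F G : T -> V) :
  continuous F -> continuous G -> continuous (fun x => F x + G x).
Proof. by move=> cF cG x; apply: cvgD; [exact: cF | exact: cG]. Qed.

Lemma continuous_sub (R : realType) (V : normedModType R) (T : topologicalType)
  (F G : T -> V) :
  continuous F -> continuous G -> continuous (fun x => F x - G x).
Proof. by move=> cF cG x; apply: cvgB; [exact: cF | exact: cG]. Qed.

Lemma continuous_scale (R : realType) (V : normedModType R)
  (T : topologicalType) (k : T -> R) (F : T -> V) :
  continuous k -> continuous F -> continuous (fun x => k x *: F x).
Proof. by move=> ck cF x; apply: cvgZ; [exact: ck | exact: cF]. Qed.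

Lemma continuous_mul (R : realType) (T : topologicalType) (F G : T -> R) :
  continuous F -> continuous G -> continuous (fun x => F x * G x).
Proof. by move=> cF cG x; apply: cvgM; [exact: cF | exact: cG]. Qed.

Lemma continuous_id (T : topologicalType) : continuous (fun x : T => x).
Proof. by move=> x; exact: cvg_id. Qed.

Lemma continuous_dotp (R : realType) (T : topologicalType) (F G : T -> R * R) :
  continuous F -> continuous G -> continuous (fun x => dotp (F x) (G x)).
Proof.
move=> cF cG.
by apply: continuous_add; apply: continuous_mul; apply: continuous_app => //;
  solve [exact: continuous_fst | exact: continuous_snd].
Qed.

(** Moving from the nearest point [q] towards a point of [D] cannot decrease the
    distance to [p], so the derivative of the squared distance at [q] has a
    sign. *)
Lemma nearest_point_normal (R : realType) (D : set (R * R)) (p : R * R) :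
  compact D -> convex_set D -> D !=set0 -> exists q, normal_at D q (p - q).
Proof.
move=> cD xD D0.
have cF : continuous (fun y : R * R => dotp (p - y) (p - y)).
  by apply: continuous_dotp; apply: continuous_sub;
    solve [exact: cst_continuous | exact: continuous_id].
have [q + qmin] := compact_EVT_min D0 cD (continuous_subspaceT cF).
rewrite inE => Dq; exists q; split => // y Dy.
rewrite leNgt; apply/negP => c0.
set c := dotp (p - q) (y - q) in c0.
set m := dotp (y - q) (y - q).
have m0 : 0 <= m by exact: dotp_ge0.
have cm0 : 0 < c + m by lra.
(* The squared distance decreases by l (2 c - l m); this l lies in ]0, 1] and
   satisfies l m < c. *)
pose l := c / (c + m).
have l0 : 0 < l by rewrite divr_gt0.
have l1 : l <= 1 by rewrite ler_pdivrMr// mul1r; lra.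
have lE : l * (c + m) = c by rewrite /l mulfVK// gt_eqF.
have := qmin (q + l *: (y - q)).
rewrite inE => /(_ (convex_segment xD Dq Dy _)); rewrite (ltW l0) l1 => /(_ isT).
have -> : dotp (p - (q + l *: (y - q))) (p - (q + l *: (y - q))) =
  dotp (p - q) (p - q) - l * (2 * c - l * m).
  by rewrite /c /m /dotp /= /GRing.scale /=; ring.
have : 0 < 2 * c - l * m by nra.
by move=> ?; rewrite leNgt => /negP; apply; rewrite ltrBlDr ltrDl mulr_gt0.
Qed.

(** Adding the two normality inequalities gives
    |q - q'|^2 <= (p - p').(q - q'), and 2 u.v <= u.u + v.v. *)
Lemma projection_nonexpansive (R : realType) (D : set (R * R)) (p p' q q' : R * R) :
  normal_at D q (p - q) -> normal_at D q' (p' - q') ->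
  dotp (q - q') (q - q') <= dotp (p - p') (p - p').
Proof.
move=> [Dq /(_ q') h] [Dq' /(_ q) h']; move: (h Dq') (h' Dq).
rewrite /dotp /= => {h h'}.
case: p p' q q' Dq Dq' => [p1 p2] [p1' p2'] [q1 q2] [q1' q2'] _ _ /= h h'.
have := sqr_ge0 ((q1 - q1') - (p1 - p1')).
have := sqr_ge0 ((q2 - q2') - (p2 - p2')).
nra.
Qed.

Lemma dotp_norm_lt (R : realType) (u v : R * R) (e : R) :
  dotp u u <= dotp v v -> `|v| < e / 2 -> `|u| < e.
Proof.
case: u v => [u1 u2] [v1 v2]; rewrite !prod_normE !gt_max /= !ltr_norml /dotp /=.
move=> h /andP[/andP[a b] /andP[c d]].
have e0 : 0 < e by lra.
have v1e : v1 * v1 < (e / 2) ^+ 2 by nra.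
have v2e : v2 * v2 < (e / 2) ^+ 2 by nra.
have {a b c d} vv : u1 * u1 + u2 * u2 < e * e by nra.
have := sqr_ge0 u1; have := sqr_ge0 u2.
by move=> *; apply/andP; split; apply/andP; split; nra.
Qed.

Lemma continuous_projection (R : realType) (D : set (R * R)) (pr : R * R -> R * R) :
  (forall p, normal_at D (pr p) (p - pr p)) -> continuous pr.
Proof.
move=> prP p; apply/cvgrPdist_lt => e e0.
have e2 : 0 < e / 2 by rewrite divr_gt0.
move/cvgrPdist_lt : (@cvg_id _ (nbhs p)) => /(_ _ e2); apply: filterS => p' /=.
exact/dotp_norm_lt/(projection_nonexpansive (prP p) (prP p')).
Qed.

Lemma normal_boundary (R : realType) (D : set (R * R)) (q n : R * R) :
  normal_at D q n -> n <> 0 -> boundary D q.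
Proof.
move=> [Dq qn] n0; split; first exact: subset_closure.
move=> qi; apply: n0; apply: dotp_eq0.
have : q + e *: n @[e --> (0 : R)^'+] --> q.
  rewrite -[X in _ --> X]addr0 -[X in q + X](scale0r n).
  apply: cvgD; first exact: cvg_cst.
  apply: cvgZr_tmp; exact: cvg_within.
move=> /(_ D qi) qD.
near ((0 : R)^'+) => e.
have e0 : 0 < e by [].
have /qn : D (q + e *: n) by near: e; exact: qD.
rewrite addrC addKr.
have -> : dotp n (e *: n) = e * dotp n n by rewrite /dotp /= /GRing.scale /=; ring.
by rewrite pmulr_rle0.
Unshelve. all: by end_near. Qed.

Lemma dist_to_le (R : realType) (x y : R * R) (A : set (R * R)) :
  A y -> dist_to x A <= edist2 x y.
Proof.
move=> Ay; apply: ge_inf; last by exists y.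
by exists 0 => _ [z _ <-]; exact: sqrtr_ge0.
Qed.

(** * Squares and discrete gradients *)

Definition rot90 (R : realType) (e : R * R) : R * R := (- e.2, e.1).

Definition skew (R : realType) (f : R * R -> R) (q e : R * R) : R :=
  f (q + e) - f (q - e).

Definition discrete_gradient (R : realType) (f : R * R -> R) (q e : R * R) :
    R * R :=
  skew f q e *: e + skew f q (rot90 e) *: rot90 e.

Definition diagonal_gap (R : realType) (f : R * R -> R) (q e : R * R) : R :=
  (f (q + e) + f (q - e)) - (f (q + rot90 e) + f (q - rot90 e)).

(** The rational parametrization of the circle: [0, 1] is mapped onto the
    quarter of circle from (1, 0) to (0, 1). *)
Definition dir (R : realType) (t : R) : R * R :=
  ((1 - t * t) / (1 + t * t), (2 * t) / (1 + t * t)).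

Lemma rot90K (R : realType) (e : R * R) : rot90 (rot90 e) = - e.
Proof. by []. Qed.

Lemma dotp_rot90 (R : realType) (e : R * R) : dotp (rot90 e) (rot90 e) = dotp e e.
Proof. by rewrite /dotp /=; ring. Qed.

Lemma discrete_gradient_rot90 (R : realType) (f : R * R -> R) (q e : R * R) :
  discrete_gradient f q (rot90 e) = discrete_gradient f q e.
Proof.
rewrite /discrete_gradient rot90K addrC; congr (_ + _).
by rewrite /skew opprK scalerN -scaleNr opprB.
Qed.

Lemma diagonal_gap_rot90 (R : realType) (f : R * R -> R) (q e : R * R) :
  diagonal_gap f q (rot90 e) = - diagonal_gap f q e.
Proof. by rewrite /diagonal_gap rot90K opprK; ring. Qed.

Lemma dir0 (R : realType) : dir (0 : R) = (1, 0).
Proof. by rewrite /dir !mulr0 subr0 addr0 divr1 mul0r. Qed.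

Lemma dir1 (R : realType) : dir (1 : R) = rot90 (dir 0).
Proof.
rewrite dir0 /rot90 /dir /= !mulr1 subrr mul0r oppr0 divff //.
Qed.

Lemma dir_den (R : realType) (t : R) : 1 + t * t != 0.
Proof. by rewrite gt_eqF//; nra. Qed.

Lemma dotp_dir (R : realType) (t : R) : dotp (dir t) (dir t) = 1.
Proof. by rewrite /dotp /dir /=; field; exact: dir_den. Qed.

Lemma continuous_dir (R : realType) : continuous (@dir R).
Proof.
have cden : continuous (fun t : R => (1 + t * t)^-1).
  move=> t; apply: cvgV; first exact: dir_den.
  by apply: cvgD; [exact: cvg_cst | apply: cvgM; exact: cvg_id].
apply: continuous_pair; apply: continuous_mul => //.
  apply: continuous_sub; first exact: cst_continuous.
  by apply: continuous_mul; exact: continuous_id.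
by apply: continuous_mul; [exact: cst_continuous | exact: continuous_id].
Qed.

Lemma discrete_gradient_eq0 (R : realType) (f : R * R -> R) (q e : R * R) :
  e <> 0 -> discrete_gradient f q e = 0 ->
  skew f q e = 0 /\ skew f q (rot90 e) = 0.
Proof.
move=> e0; have ee : 0 < dotp e e.
  by rewrite ltNge; apply/negP => /dotp_eq0.
move: e ee {e0} => [a b]; rewrite /discrete_gradient.
set s1 := skew _ _ _; set s2 := skew _ _ _.
rewrite /dotp /rot90 /= => ee; rewrite /GRing.scale /= => -[h1 h2].
(* The scalars are recovered by pairing the vector with e and with rot90 e. *)
split; apply/eqP; rewrite -(mulrI_eq0 _ (lregP (lt0r_neq0 ee))); apply/eqP.
  have -> : (a * a + b * b) * s1 =
    a * (s1 * a + s2 * - b) + b * (s1 * b + s2 * a) by ring.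
  by rewrite /GRing.scale /= in h1 h2 *; rewrite h1 h2; ring.
have -> : (a * a + b * b) * s2 =
  a * (s1 * b + s2 * a) - b * (s1 * a + s2 * - b) by ring.
by rewrite /GRing.scale /= in h1 h2 *; rewrite h1 h2; ring.
Qed.

Lemma square_of_halfdiagonal (R : realType) (p e : R * R) (a : R) :
  0 <= a -> a ^+ 2 = 2 * dotp e e ->
  is_square p a (p + e) (p + rot90 e) (p - e) (p - rot90 e).
Proof.
move=> a0 ae.
have len u v : dotp (u - v) (u - v) = a ^+ 2 -> edist2 u v = a.
  by rewrite /edist2 => ->; rewrite sqrtr_sqr ger0_norm.
have mid u : 2^-1 *: ((p + u) + (p - u)) = p.
  by apply: injective_projections; rewrite /= /GRing.scale /=; field.
split; rewrite ?mid//; try (apply: len; rewrite ae).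
all: by rewrite /dotp /=; ring.
Qed.

(** The supporting line at [q] leaves one of [q + e] and [q - e] outside [D],
    unless [e] is parallel to it. At that point f is both >= 0 and <= 0, and it
    is <= 0 at the other one. *)
Lemma skew_dotp_normal_ge0 (R : realType) (D : set (R * R)) (delta : R)
    (f : R * R -> R) (q n e : R * R) :
  (forall x, ~ D x -> 0 <= f x) ->
  (forall x, dist_to x (boundary D) <= delta -> f x <= 0) ->
  normal_at D q n -> n <> 0 -> Num.sqrt (dotp e e) <= delta ->
  0 <= dotp n e * skew f q e.
Proof.
move=> fout fnear qn n0 edelta.
have half u : Num.sqrt (dotp u u) <= delta -> 0 < dotp n u -> 0 <= skew f q u.
  move=> ud nu.
  have near_q v : dotp v v = dotp u u -> f (q + v) <= 0.
    move=> vu; apply: fnear.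
    apply: (le_trans (dist_to_le _ (normal_boundary qn n0))).
    by rewrite /edist2 (addrC q) addrK vu.
  rewrite subr_ge0; apply: (@le_trans _ _ 0).
    by apply: near_q; rewrite /dotp /=; ring.
  apply: fout => /(proj2 qn); rewrite (addrC q) addrK leNgt => /negP; exact.
have [ne|ne|<-] := ltgtP 0 (dotp n e); last by rewrite mul0r.
  by rewrite mulr_ge0 ?half// ltW.
rewrite -mulrNN mulr_ge0//; first by lra.
have -> : - skew f q e = skew f q (- e) by rewrite /skew opprK opprB.
apply: half.
  by have -> : dotp (- e) (- e) = dotp e e by rewrite /dotp /=; ring.
by have -> : dotp n (- e) = - dotp n e; [rewrite /dotp /=; ring|lra].
Qed.

Lemma dotp_discrete_gradient (R : realType) (f : R * R -> R) (q n e : R * R) :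
  dotp n (discrete_gradient f q e) =
  dotp n e * skew f q e + dotp n (rot90 e) * skew f q (rot90 e).
Proof.
rewrite /discrete_gradient; set s1 := skew _ _ _; set s2 := skew _ _ _.
by rewrite /dotp /rot90 /= /GRing.scale /=; ring.
Qed.

Lemma continuous_skew (R : realType) (T : topologicalType) (f : R * R -> R)
    (q e : T -> R * R) :
  continuous f -> continuous q -> continuous e ->
  continuous (fun x => skew f (q x) (e x)).
Proof.
by move=> cf cq ce; apply: continuous_sub; apply: continuous_app => //;
  [exact: continuous_add | exact: continuous_sub].
Qed.

Lemma continuous_rot90 (R : realType) : continuous (@rot90 R).
Proof.
apply: continuous_pair; last exact: continuous_fst.
by move=> x; apply: cvgN; exact: cvg_snd.
Qed.

(** A common zero of W and of the diagonal gap at the projected center is the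
    required square: at a zero of W the center is its own projection. *)
Lemma square_of_nonneg_outside (R : realType) (D : set (R * R)) (delta : R)
    (f : R * R -> R) (a : R) :
  compact_convex_domain D -> continuous f ->
  (forall x, ~ D x -> 0 <= f x) ->
  (forall x, dist_to x (boundary D) <= delta -> f x <= 0) ->
  0 < a -> a < Num.sqrt 2 / 2 * delta ->
  exists p : R * R, D p /\
    exists v1 v2 v3 v4 : R * R,
      is_square p a v1 v2 v3 v4 /\
      [/\ f v1 = f v2, f v2 = f v3 & f v3 = f v4].
Proof.
move=> [cD xD [x0 /interior_subset Dx0]] cf fout fnear a0 adelta.
have [pr prP] := choice (fun p => nearest_point_normal p cD xD (ex_intro _ x0 Dx0)).
have cpr := continuous_projection prP.
have s2 : Num.sqrt 2 * Num.sqrt 2 = 2 :> R by rewrite -expr2 sqr_sqrtr.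
have s2_gt0 : 0 < Num.sqrt 2 :> R by rewrite sqrtr_gt0.
pose r := a / Num.sqrt 2.
have r0 : 0 < r by rewrite divr_gt0.
have rs : r * Num.sqrt 2 = a by rewrite /r mulfVK// gt_eqF.
have rdelta : r <= delta by nra.
pose arm t := r *: dir t.
have arm2 t : dotp (arm t) (arm t) = r ^+ 2.
  transitivity (r ^+ 2 * dotp (dir t) (dir t)); last by rewrite dotp_dir mulr1.
  by rewrite /arm /dotp /= /GRing.scale /=; ring.
have carm : continuous arm.
  by apply: continuous_scale; [exact: cst_continuous | exact: continuous_dir].
have arm1 : arm 1 = rot90 (arm 0).
  by rewrite /arm dir1; apply: injective_projections; rewrite //= /GRing.scale /=; ring.
have crot := @continuous_rot90 R.
pose W p t := discrete_gradient f (pr p) (arm t) + (p - pr p).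
have W_zero p t : W p t = 0 -> D p /\ discrete_gradient f p (arm t) = 0.
  move=> Wp0.
  suff n0 : p - pr p = 0.
    have prp : pr p = p by apply/esym/eqP; rewrite -subr_eq0 n0.
    by move: Wp0 (prP p); rewrite /W prp subrr addr0 => -> [].
  apply: contrapT => n0.
  have len : Num.sqrt (dotp (arm t) (arm t)) <= delta.
    by rewrite arm2 sqrtr_sqr gtr0_norm.
  have h1 := skew_dotp_normal_ge0 fout fnear (prP p) n0 len.
  rewrite -dotp_rot90 in len.
  have h2 := skew_dotp_normal_ge0 fout fnear (prP p) n0 len.
  apply/n0/dotp_eq0.
  have : dotp (p - pr p) (W p t) = 0 by rewrite Wp0 /dotp /= !mulr0 addr0.
  have -> : dotp (p - pr p) (W p t) =
     dotp (p - pr p) (discrete_gradient f (pr p) (arm t)) + dotp (p - pr p) (p - pr p).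
    by rewrite /W /dotp /=; ring.
  by rewrite dotp_discrete_gradient; lra.
(* W(p, t) = p + B(pr p, t), where B is bounded on the compact set D x [0, 1]. *)
pose B (z : R * R * R) := discrete_gradient f z.1 (arm z.2) - z.1.
have cB : continuous B.
  apply: continuous_sub; last exact: continuous_fst.
  have c1 : continuous (fun z : R * R * R => arm z.2).
    by apply: continuous_app => //; exact: continuous_snd.
  have c2 : continuous (fun z : R * R * R => rot90 (arm z.2)).
    exact: continuous_app.
  by apply: continuous_add; apply: continuous_scale => //;
    apply: continuous_skew => //; exact: continuous_fst.
have [M MB] : exists M, forall q t, D q -> `[0, 1]%classic t -> `|B (q, t)| < M.
  have cK : compact (D `*` `[0, 1]%classic : set (R * R * R)).
    by apply: compact_setX => //; exact: segment_compact.
  have /ex_strict_bound_gt0[M M0 hM] : bounded_set (B @` (D `*` `[0, 1]%classic)).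
    by apply/compact_bounded/continuous_compact => //; exact: continuous_subspaceT.
  by exists M => q t Dq It; apply: hM; exists (q, t).
have M0 : 0 < M.
  apply: le_lt_trans (normr_ge0 _) (MB x0 0 Dx0 _).
  by rewrite /= in_itv /= lexx ler01.
(* P maps the unit square onto the box [-M, M]^2, on whose faces B is too small to
   change the sign of the dominant coordinate. *)
pose P (z : R * R * R) : R * R := (M * (2 * z.1.1 - 1), M * (2 * z.1.2 - 1)).
have cP : continuous P.
  by apply: continuous_pair; apply: continuous_mul;
    [exact: cst_continuous | | exact: cst_continuous |];
    apply: continuous_sub; try exact: cst_continuous;
    apply: continuous_mul; try exact: cst_continuous;
    apply: continuous_app; solve [exact: continuous_fst | exact: continuous_snd].
have WB p t : W p t = p + B (pr p, t) by rewrite /W /B /= addrCA addrA.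
have Wper p : W p 1 = W p 0 by rewrite /W arm1 discrete_gradient_rot90.
have WP u v t : W (P (u, v, t)) (u, v, t).2 =
    P (u, v, t) + B (pr (P (u, v, t)), t) by exact: WB.
have cpP : continuous (fun z => pr (P z)) by exact: continuous_app.
have cW : continuous (fun z => W (P z) z.2).
  have -> : (fun z => W (P z) z.2) = (fun z => P z + B (pr (P z), z.2)).
    by apply/funext => z; exact: WB.
  apply: continuous_add => //; apply: continuous_app => //.
  by apply: continuous_pair => //; exact: continuous_snd.
have WM p t : `[0, 1]%classic t ->
    `|(B (pr p, t)).1| < M /\ `|(B (pr p, t)).2| < M.
  move=> It; have := MB _ _ (proj1 (prP p)) It.
  by rewrite prod_normE gt_max => /andP.
have [||||||z [W1 W2 G0]] := @antiperiodic_common_zero R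
   (fun z => (W (P z) z.2).1) (fun z => (W (P z) z.2).2)
   (fun z => diagonal_gap f (pr (P z)) (arm z.2)).
- by apply: continuous_app => //; exact: continuous_fst.
- by apply: continuous_app => //; exact: continuous_snd.
- have c1 : continuous (fun z : R * R * R => arm z.2).
    by apply: continuous_app => //; exact: continuous_snd.
  have c2 : continuous (fun z : R * R * R => rot90 (arm z.2)).
    exact: continuous_app.
  by apply: continuous_sub; apply: continuous_add; apply: continuous_app => //;
    solve [exact: continuous_add | exact: continuous_sub].
- move=> v t _ It; cbv beta; rewrite !WP.
  have [+ _] := WM (P (0, v, t)) t It; have [+ _] := WM (P (1, v, t)) t It.
  case: (B (pr (P (0, v, t)), t)) (B (pr (P (1, v, t)), t)) => [b1 b2] [c1 c2] /=.
  by rewrite !ltr_norml => /andP[? _] /andP[_ ?]; split; lra.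
- move=> v t _ It; cbv beta; rewrite !WP.
  have [_ +] := WM (P (v, 0, t)) t It; have [_ +] := WM (P (v, 1, t)) t It.
  case: (B (pr (P (v, 0, t)), t)) (B (pr (P (v, 1, t)), t)) => [b1 b2] [c1 c2] /=.
  by rewrite !ltr_norml => /andP[? _] /andP[_ ?]; split; lra.
- move=> u v _ _; split.
  + exact: (congr1 fst (Wper (P (u, v, 0)))).
  + exact: (congr1 snd (Wper (P (u, v, 0)))).
  + by rewrite -diagonal_gap_rot90 -arm1.
have [Dp grad0] : D (P z) /\ discrete_gradient f (P z) (arm z.2) = 0.
  by apply: W_zero; exact: injective_projections.
have prp : pr (P z) = P z.
  have [_ /(_ _ Dp) h] := prP (P z).
  by apply/esym/eqP; rewrite -subr_eq0; apply/eqP/dotp_eq0.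
rewrite prp in G0.
have armN0 : arm z.2 <> 0.
  move=> e0; have := arm2 z.2; rewrite e0 /dotp /= mulr0 addr0.
  by move/eqP; rewrite eq_sym expf_eq0 /= gt_eqF.
have [S1 S2] := discrete_gradient_eq0 armN0 grad0.
exists (P z); split => //.
exists (P z + arm z.2), (P z + rot90 (arm z.2)), (P z - arm z.2),
  (P z - rot90 (arm z.2)); split.
  by apply: square_of_halfdiagonal; [exact: ltW | rewrite arm2 -rs; nra].
by move: S1 S2 G0; rewrite /skew /diagonal_gap => *; split; lra.
Qed.

Theorem theorem3p1 (R : realType) (D : set (R * R)) (delta : R)
    (f : R * R -> R) :
  compact_convex_domain D ->
  0 < delta ->
  continuous f ->
  ((forall x, ~ D x -> 0 <= f x) /\
   (forall x, dist_to x (boundary D) <= delta -> f x <= 0)) \/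
  ((forall x, ~ D x -> f x <= 0) /\
   (forall x, dist_to x (boundary D) <= delta -> 0 <= f x)) ->
  forall a : R, 0 < a -> a < Num.sqrt 2 / 2 * delta ->
  exists p : R * R, D p /\
    exists v1 v2 v3 v4 : R * R,
      is_square p a v1 v2 v3 v4 /\
      [/\ f v1 = f v2, f v2 = f v3 & f v3 = f v4].
Proof.
move=> hD _ cf [[fout fnear]|[fout fnear]] a a0 adelta.
  exact: square_of_nonneg_outside hD cf fout fnear a0 adelta.
have cNf : continuous (fun x => - f x) by move=> x; apply: cvgN; exact: cf.
have [||p [Dp [v1 [v2 [v3 [v4 [sq [h12 h23 h34]]]]]]]] :=
  square_of_nonneg_outside hD cNf _ _ a0 adelta.
- by move=> x /fout; rewrite oppr_ge0.
- by move=> x /fnear; rewrite oppr_le0.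
exists p; split => //; exists v1, v2, v3, v4; split => //.
by split; exact: oppr_inj.
Qed.
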